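(* Let $\Gamma=(V,E,\mathrm{wt},\nu)$ be an edge-weighted $\mathbb Z/2\mathbb Z$-voltage directed multigraph, and let $\mathscr L(\Gamma)$ be its voltage Laplacian matrix. Then for any vertex $v$ of $\Gamma$ with $A_v(\Gamma)\neq0$ and any lift $\tilde v$ of $v$ in the derived graph $\tilde\Gamma$ of $\Gamma$, $$\frac{A_{\tilde v}(\tilde\Gamma)}{A_v(\Gamma)}=\frac12\det[\mathscr L(\Gamma)].$$
   Context: Graphs are finite directed multigraphs (loops and multiple edges allowed). The edge weights $\mathrm{wt}(e)$, $e\in E$, of $\Gamma$ are distinct indeterminates; $\mathbb Z[E]$ denotes the polynomial ring over $\mathbb Z$ in them. Label the vertices $v_1,\dots,v_n$; $E_s(v)$ is the set of edges with source $v$, and $e=(v,w)$ means $e$ has source $v$ and target $w$. An arborescence of a graph rooted at $v$ is a spanning tree directed towards $v$ (every vertex has a unique directed path to $v$ in the tree). Its weight is the product of its edge weights, and $A_v(\cdot)$ is the sum of weights of all arborescences rooted at $v$. For a finite group $G$, a $G$-voltage graph is a weighted directed multigraph with a map $\nu:E\to G$. Its derived graph $\tilde\Gamma$ has vertex set $V\times G$ and, for each edge $e=(v,w)$ of $\Gamma$ and each $x\in G$, an edge from $(v,x)$ to $(w,\nu(e)x)$ of weight $\mathrm{wt}(e)$. A lift of $v$ is a vertex $(v,x)$. The reduced group algebra is $\overline{\mathbb Z[G]}=\mathbb Z[G]/\langle\sum_{g\in G}g\rangle$; for $G=\mathbb Z/2\mathbb Z$ it is identified with $\mathbb Z$, the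 non-identity element being identified with $-1$. The voltage Laplacian is $\mathscr L(\Gamma)=D(\Gamma)-\mathscr A(\Gamma)$ (entries in $\mathbb Z[E]$), where $D(\Gamma)$ is the diagonal matrix with entries $d_{ii}=\sum_{e\in E_s(v_i)}\mathrm{wt}(e)$ and $\mathscr A(\Gamma)$ has entries $a_{ij}=\sum_{e=(v_i,v_j)}\nu(e)\,\mathrm{wt}(e)$ with $\nu(e)\in\{1,-1\}$ under this identification. *)

(* Defs.v *)
From mathcomp Require Import all_boot all_order all_fingroup all_algebra.
From mathcomp Require Import fraction mpoly boolp.

Set Implicit Arguments.
Unset Strict Implicit.
Unset Printing Implicit Defensive.

Import GRing.Theory.
Local Open Scope ring_scope.

Record digraph := Digraph {
  vertex : finType;
  edge : finType;
  source : edge -> vertex;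
  target : edge -> vertex
}.

Fixpoint walk (Gam : digraph) (u : vertex Gam) (p : seq (edge Gam))
    (w : vertex Gam) : bool :=
  if p is e :: p' then (source e == u) && walk (target e) p' w else u == w.

Definition dipath_in (Gam : digraph) (T : {set edge Gam}) (u : vertex Gam)
    (p : seq (edge Gam)) (w : vertex Gam) : bool :=
  [&& walk u p w, all (mem T) p & uniq (u :: map (@target Gam) p)].

(* The underlying undirected multigraph: (e, true) is e traversed from source
   to target, (e, false) is e traversed backwards. *)
Definition undirected (Gam : digraph) : digraph :=
  @Digraph (vertex Gam) (edge Gam * bool)%type
    (fun d => if d.2 then source d.1 else target d.1)
    (fun d => if d.2 then target d.1 else source d.1).

Definition undirected_walk_in (Gam : digraph) (T : {set edge Gam})
    (u : vertex Gam) (p : seq (edge Gam * bool)) (w : vertex Gam) : bool :=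
  @walk (undirected Gam) u p w && all (fun d => d.1 \in T) p.

(* A loop and a pair of parallel edges are cycles; uniq (map fst p) keeps an
   edge followed by its own reversal from being one, and is redundant for
   length other than 2. *)
Definition cycle_in (Gam : digraph) (T : {set edge Gam}) (u : vertex Gam)
    (p : seq (edge Gam * bool)) : bool :=
  [&& undirected_walk_in T u p u, p != [::],
      uniq (map (@source (undirected Gam)) p) & uniq (map fst p)].

Definition spanning_tree (Gam : digraph) (T : {set edge Gam}) : Prop :=
  (forall u w, exists p, undirected_walk_in T u p w) /\
  (forall u p, ~~ cycle_in T u p).

Definition arborescence (Gam : digraph) (v : vertex Gam)
    (T : {set edge Gam}) : Prop :=
  spanning_tree T /\ (forall u, exists! p, dipath_in T u p v).

Definition arborescence_sum (R : comPzRingType) (Gam : digraph)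
    (wt : edge Gam -> R) (v : vertex Gam) : R :=
  \sum_(T : {set edge Gam} | `[< arborescence v T >]) \prod_(e in T) wt e.

Record voltage_graph (G : finGroupType) := VoltageGraph {
  base :> digraph;
  voltage : edge base -> G
}.

Definition derived_graph (G : finGroupType) (Gam : voltage_graph G) : digraph :=
  @Digraph (vertex Gam * G)%type (edge Gam * G)%type
    (fun ex => (source ex.1, ex.2))
    (fun ex => (target ex.1, (voltage ex.1 * ex.2)%g)).

Definition derived_weight (R : Type) (G : finGroupType)
    (Gam : voltage_graph G) (wt : edge Gam -> R)
    (ex : edge (derived_graph Gam)) : R := wt ex.1.

Definition is_lift (G : finGroupType) (Gam : voltage_graph G)
    (v : vertex Gam) (vt : vertex (derived_graph Gam)) : Prop := vt.1 = v.

Notation edge_poly Gam := {mpoly int[#|edge Gam|]}.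

Definition weight (Gam : digraph) (e : edge Gam) : edge_poly Gam :=
  'X_(enum_rank e).

(* The group law of 'Z_2 : finGroupType is addition, so 1%g is the residue 0.
   The reduced group algebra Z[g]/(g^2 - 1, 1 + g) is Z, with g = -1. *)
Definition reduced_Z2 (R : pzRingType) (g : 'Z_2) : R :=
  if g == 1%g then 1 else -1.

Definition degree_matrix (Gam : digraph) : 'M[edge_poly Gam]_#|vertex Gam| :=
  \matrix_(i, j) if i == j
    then \sum_(e : edge Gam | source e == enum_val i) weight e else 0.

Definition voltage_adjacency (Gam : voltage_graph 'Z_2) :
    'M[edge_poly Gam]_#|vertex Gam| :=
  \matrix_(i, j)
    \sum_(e : edge Gam | (source e == enum_val i) && (target e == enum_val j))
      reduced_Z2 (edge_poly Gam) (voltage e) * weight e.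

Definition voltage_laplacian (Gam : voltage_graph 'Z_2) :
    'M[edge_poly Gam]_#|vertex Gam| :=
  degree_matrix Gam - voltage_adjacency Gam.

(* Main.v *)
Require Import Defs.
From mathcomp Require Import all_boot all_order all_fingroup all_algebra.
From mathcomp Require Import fraction mpoly boolp ring.

Set Implicit Arguments.
Unset Strict Implicit.
Unset Printing Implicit Defensive.

Import GRing.Theory.
Local Open Scope ring_scope.

(** Write L for the Laplacian of the base graph, Lt for that of its double
    cover, and S for the voltage Laplacian.

    The matrix-tree theorem ([matrix_tree]) says that A_v is the determinant of
    the Laplacian in which the row of v has been replaced by the unit vector at
    v.  For its proof, every row u other than v is the sum, over the edges e
    out of u, of wt(e) times (unit vector at u - unit vector at target e).
    Expanding by rows gives one term for each parent function, that is for each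
    choice of an out-edge at every vertex other than v, and the determinant that
    remains is 1 if following the choices always leads to v and 0 otherwise
    ([fdet_parent_rows]).  The choices that always lead to v are exactly the
    arborescences ([arborescence_parent], [parent_arborescence]).

    Sorting the vertices of the cover by sheet, Lt is the block matrix with rows
    (P, Q) and (Q, P), where P + Q = L and P - Q = S; hence
    det Lt = det L * det S.  This only says 0 = 0, so it is perturbed: adding t
    to the diagonal entry of v in both sheets keeps the block form, and
      det (Lt + t E) = det (L + t E_v) * det (S + t E_v)
    ([double_cover_fdet]).  By the matrix-tree theorem the coefficient of t is
    the sum of the arborescence sums at the two lifts of v on the left, and
    A_v * det S on the right.  The deck transformation exchanges the two lifts,
    so the left-hand sum is twice the arborescence sum at one lift
    ([lift_independent]). *)

(** * Determinants indexed by a finite type *)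

(** Indexing by the vertices themselves lets determinants be transported along
    bijections, such as the one between the vertices of a double cover and two
    copies of those of its base. *)
Definition fdet (R : comPzRingType) (T : finType) (M : T -> T -> R) : R :=
  \det (\matrix_(i, j < #|T|) M (enum_val i) (enum_val j)).

Definition pin_row (R : comPzRingType) (T : finType) (v : T) (M : T -> T -> R)
    (x y : T) : R :=
  if x == v then (y == v)%:R else M x y.

Definition add_diag (R : comPzRingType) (T : finType) (v : T) (t : R)
    (M : T -> T -> R) (x y : T) : R :=
  M x y + (if (x == v) && (y == v) then t else 0).

Lemma eq_fdet (R : comPzRingType) (T : finType) (M N : T -> T -> R) :
  (forall x y, M x y = N x y) -> fdet M = fdet N.
Proof.
by move=> eqMN; congr (\det _); apply/matrixP=> i j; rewrite !mxE eqMN.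
Qed.

(** Another enumeration permutes rows and columns alike, so the two signs
    cancel. *)
Lemma fdet_bij (R : comPzRingType) (T : finType) (n : nat) (h : 'I_n -> T)
    (M : T -> T -> R) :
  bijective h -> \det (\matrix_(i, j) M (h i) (h j)) = fdet M.
Proof.
move=> bij_h; have eqn : n = #|T| by rewrite -(bij_eq_card bij_h) card_ord.
subst n.
pose k i := enum_rank (h i).
have inj_k : injective k by apply: inj_comp enum_rank_inj (bij_inj bij_h).
pose s := perm inj_k.
rewrite /fdet; set A := (X in _ = \det X).
have -> : \matrix_(i, j) M (h i) (h j) = row_perm s (col_perm s A).
  by apply/matrixP=> i j; rewrite !mxE !permE !enum_rankK.
rewrite row_permE col_permE !det_mulmx !det_perm odd_permV mulrCA.
by rewrite -signr_addb addbb mulr1.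
Qed.

Lemma fdet_reindex (R : comPzRingType) (S T : finType) (h : S -> T)
    (M : T -> T -> R) :
  bijective h -> fdet (fun x y => M (h x) (h y)) = fdet M.
Proof.
move=> bij_h; by rewrite -(fdet_bij _ (bij_comp bij_h (enum_val_bij S))).
Qed.

(** Multilinearity in all rows at once: if each row is a combination of vectors
    N x o, the determinant is the sum over all ways to pick one vector per
    row. *)
Lemma fdet_sum_rows (R : comPzRingType) (T O : finType) (Q : T -> pred O)
    (c : T -> O -> R) (N : T -> O -> T -> R) :
  fdet (fun x y => \sum_(o | Q x o) c x o * N x o y)
  = \sum_(f : {ffun T -> O} | f \in family Q)
      (\prod_x c x (f x)) * fdet (fun x y => N x (f x) y).
Proof.
have prodE (F : T -> R) : \prod_(i < #|T|) F (enum_val i) = \prod_x F x.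
  rewrite [RHS](reindex (@enum_val T T)) //.
  exact/onW_bij/enum_val_bij.
have leibniz (M : T -> T -> R) : fdet M =
    \sum_(s : {perm 'I_#|T|})
      (-1) ^+ s * \prod_x M x (enum_val (s (enum_rank x))).
  apply: eq_bigr => s _; congr (_ * _).
  by rewrite -prodE; apply: eq_bigr => i _; rewrite mxE enum_valK.
rewrite leibniz.
under eq_bigr => s _ do
  rewrite (bigA_distr_big_dep Q (fun x o => c x o * N x o _)) mulr_sumr.
rewrite exchange_big; apply: eq_bigr => f _ /=.
rewrite leibniz mulr_sumr; apply: eq_bigr => s _.
by rewrite big_split mulrCA.
Qed.

(** The adjugate turns a kernel vector with a coordinate 1 into a proof that
    the determinant vanishes, over an arbitrary commutative ring. *)
Lemma fdet_kernel (R : comPzRingType) (T : finType) (M : T -> T -> R)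
    (c : T -> R) (x0 : T) :
  (forall x, \sum_y M x y * c y = 0) -> c x0 = 1 -> fdet M = 0.
Proof.
move=> ker_c c1; rewrite /fdet; set A := (X in \det X).
pose u := \col_(i < #|T|) c (enum_val i).
have Au : A *m u = 0.
  apply/matrixP=> i j; rewrite !mxE -[RHS](ker_c (enum_val i)).
  rewrite [RHS](reindex (@enum_val T T)); last exact/onW_bij/enum_val_bij.
  by apply: eq_bigr => k _; rewrite !mxE.
have := congr1 (fun B : 'cV_ _ => B (enum_rank x0) 0)
  (mulmxA (\adj A) A u).
by rewrite Au mulmx0 mul_adj_mx mul_scalar_mx !mxE enum_rankK c1 mulr1.
Qed.

Lemma fdet_add_diag (R : comPzRingType) (T : finType) (v : T) (t : R)
    (M : T -> T -> R) :
  fdet (add_diag v t M) = fdet M + t * fdet (pin_row v M).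
Proof.
rewrite -[fdet M]mul1r /fdet; apply: (@determinant_multilinear _ _ _ _ _
  (enum_rank v)).
- apply/rowP=> j; rewrite !mxE enum_rankK /add_diag /pin_row eqxx /= mul1r.
  by case: eqP; rewrite ?mulr1 ?mulr0.
- apply/matrixP=> i j; rewrite !mxE /add_diag.
  suff /negPf -> : enum_val (lift (enum_rank v) i) != v by rewrite addr0.
  by rewrite -(inj_eq enum_rank_inj) enum_valK eq_sym neq_lift.
apply/matrixP=> i j; rewrite !mxE /add_diag /pin_row.
suff /negPf -> : enum_val (lift (enum_rank v) i) != v by rewrite addr0.
by rewrite -(inj_eq enum_rank_inj) enum_valK eq_sym neq_lift.
Qed.

(** The change of basis that splits two interchangeable blocks into a symmetric
    and an antisymmetric part makes the matrix block triangular; it uses no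
    division by 2. *)
Lemma det_block_swap (R : comPzRingType) (n : nat) (P Q : 'M[R]_n) :
  \det (block_mx P Q Q P) = \det (P + Q) * \det (P - Q).
Proof.
rewrite -(det_ublock _ Q).
have <- : block_mx 1%:M 0 (- 1%:M) 1%:M *m block_mx P Q Q P
   *m block_mx 1%:M 0 1%:M 1%:M = block_mx (P + Q) Q 0 (P - Q).
  rewrite !mulmx_block !mul1mx !mulmx1 !mul0mx !mulmx0 !mulNmx !mul1mx.
  rewrite !addr0 !add0r; congr block_mx; last exact: addrC.
  by rewrite [- P + Q]addrC addrACA subrr addNr addr0.
by rewrite !det_mulmx !det_lblock !det1 !mul1r !mulr1.
Qed.

(** * Arborescences as parent functions *)

Lemma uniq_map_inj (S T : eqType) (f : S -> T) (s : seq S) :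
  uniq (map f s) -> {in s &, injective f}.
Proof.
elim: s => [|a s IHs] //= /andP[nfa us] x y; rewrite !inE.
move=> /predU1P[->|xs] /predU1P[->|ys] // fxy.
- by case/negP: nfa; rewrite fxy map_f.
- by case/negP: nfa; rewrite -fxy map_f.
exact: IHs fxy.
Qed.

(** A parent function picks an out-edge at every vertex but the root, where
    None marks the absence of one. *)
Definition parent_choice (Gam : digraph) (v u : vertex Gam)
    (o : option (edge Gam)) : bool :=
  if o is Some e then (source e == u) && (u != v) else u == v.

Definition step (Gam : digraph)
    (f : {ffun vertex Gam -> option (edge Gam)}) (u : vertex Gam) :
    vertex Gam :=
  if f u is Some e then target e else u.

Definition reaches (Gam : digraph) (v : vertex Gam)
    (f : {ffun vertex Gam -> option (edge Gam)}) : bool :=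
  [forall u, fconnect (step f) u v].

Definition parent_edges (Gam : digraph)
    (f : {ffun vertex Gam -> option (edge Gam)}) : {set edge Gam} :=
  [set e | f (source e) == Some e].

Definition parent_of (Gam : digraph) (T : {set edge Gam}) :
    {ffun vertex Gam -> option (edge Gam)} :=
  [ffun u => [pick e in T | source e == u]].

Lemma walk_cat (Gam : digraph) (u w : vertex Gam) p q :
  walk u (p ++ q) w = walk u p (last u (map (@target Gam) p))
                      && walk (last u (map (@target Gam) p)) q w.
Proof.
elim: p u => [|e p IHp] u /=; first by rewrite eqxx.
by rewrite IHp andbA.
Qed.

Lemma walk_last (Gam : digraph) (u w : vertex Gam) p :
  walk u p w -> last u (map (@target Gam) p) = w.
Proof.
elim: p u => [|e p IHp] u /=; first by move/eqP.
by case/andP=> _ /IHp.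
Qed.

Lemma walk_sources (Gam : digraph) (u w : vertex Gam) p :
  walk u p w -> rcons (map (@source Gam) p) w = u :: map (@target Gam) p.
Proof.
elim: p u => [|e p IHp] u /=; first by move/eqP->.
by case/andP=> /eqP-> /IHp ->.
Qed.

(** If a directed path that continues an edge returns to the source of that
    edge, the edge and an initial segment of the path form a cycle. *)
Lemma closing_edge_cycle (Gam : digraph) (T : {set edge Gam}) (e : edge Gam)
    p w :
  e \in T -> dipath_in T (target e) p w ->
  source e \in target e :: map (@target Gam) p ->
  exists u q, cycle_in T u q.
Proof.
move=> eT /and3P[wp pT up] se.
pose k := index (source e) (target e :: map (@target Gam) p).
pose p1 := take k p.
have lk : (k <= size p)%N.
  by move: se; rewrite -index_mem /= size_map.
have wp1 : walk (target e) p1 (source e).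
  move: wp; rewrite -{1}(cat_take_drop k p) walk_cat => /andP[+ _].
  suff -> : last (target e) (map (@target Gam) (take k p)) = source e by [].
  rewrite -[in RHS](nth_index (target e) se) -/k map_take (last_nth (target e)).
  rewrite size_take size_map; have [ltk|] := ltnP k (size p).
    by rewrite -[_ :: take _ _]/(take k.+1 (_ :: _)) nth_take.
  move=> gek; have -> : k = size p by apply/eqP; rewrite eqn_leq lk.
  by rewrite -(size_map (@target Gam)) take_size.
have up1 : uniq (target e :: map (@target Gam) p1).
  by rewrite map_take -[_ :: take _ _]/(take k.+1 (_ :: _)) take_uniq.
exists (source e), (map (fun a => (a, true)) (e :: p1)).
have usrc : uniq (map (@source Gam) (e :: p1)).
  by move: up1; rewrite -(walk_sources wp1) rcons_uniq /=.
apply/and4P; split=> //.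
- apply/andP; split; last first.
    rewrite all_map; apply/allP=> a /=; rewrite inE => /predU1P[->//|].
    by move/mem_take; apply: (allP pT).
  rewrite /= eqxx /=; elim: p1 (target e) wp1 {up1 usrc} => //= a q IHq u.
  by case/andP=> -> /IHq.
- by rewrite -map_comp (eq_map (g := @source Gam)).
rewrite -map_comp (eq_map (g := id)) // map_id.
exact: map_uniq usrc.
Qed.

(** Acyclicity together with uniqueness of paths to the root forces at most one
    out-edge per vertex: two out-edges of u, each continued to the root, give
    two paths from u, unless one of them comes back to u and closes a cycle.
    An out-edge of the root would close a cycle as well. *)
Lemma arborescence_parent (Gam : digraph) (v : vertex Gam)
    (T : {set edge Gam}) :
  arborescence v T ->
  [/\ parent_of T \in family (parent_choice v), reaches v (parent_of T)
    & parent_edges (parent_of T) = T].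
Proof.
move=> [[_ acyc] hpath].
have noback e p w : e \in T -> dipath_in T (target e) p w ->
    source e \notin target e :: map (@target Gam) p.
  move=> eT pw; apply/negP=> /(closing_edge_cycle eT pw)[u [q]].
  exact/negP/acyc.
have no_out_root e : e \in T -> source e != v.
  move=> eT; have [p [pv _]] := hpath (target e).
  have := noback _ _ _ eT pv; apply: contra => /eqP->.
  by case/and3P: pv => /walk_last <- _ _; apply: mem_last.
have uniq_out e e' : e \in T -> e' \in T -> source e = source e' -> e = e'.
  move=> eT e'T see'.
  have ext a : a \in T -> exists p, dipath_in T (source a) (a :: p) v.
    move=> aT; have [p [pv _]] := hpath (target a); exists p.
    have nb := noback _ _ _ aT pv; case/and3P: pv => wp pT up.
    by rewrite /dipath_in /= eqxx wp aT pT nb.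
  have [[p pv] [p' pv']] := (ext e eT, ext e' e'T).
  have [q [_ qU]] := hpath (source e).
  by have := qU _ pv; rewrite see' in qU *; rewrite (qU _ pv') => -[].
have par_edge e : e \in T -> parent_of T (source e) = Some e.
  move=> eT; rewrite ffunE; case: pickP => [a /andP[aT /eqP sa]|/(_ e)].
    by congr Some; apply: uniq_out.
  by rewrite eT eqxx.
have par_Some u e : parent_of T u = Some e -> e \in T /\ source e = u.
  by rewrite ffunE; case: pickP => // a /andP[aT /eqP <-] [<-].
split.
- apply/familyP=> u; rewrite unfold_in /parent_choice.
  case Eu: (parent_of T u) => [e|].
    have [eT <-] := par_Some _ _ Eu.
    by rewrite eqxx no_out_root.
  have [[|e p] [pv _]] := hpath u; first by case/and3P: pv.
  case/and3P: pv => /= /andP[/eqP se _] /andP[eT _] _.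
  by rewrite -se par_edge in Eu.
- apply/forallP=> u; have [p [/and3P[wp pT _] _]] := hpath u.
  elim: p u wp pT => [|e p IHp] u /=; first by move/eqP->.
  case/andP=> /eqP su wp /andP[eT pT].
  apply: connect_trans (IHp _ wp pT).
  by have := fconnect1 (step (parent_of T)) u; rewrite /step -su par_edge.
apply/setP=> e; rewrite inE; apply/eqP/idP => [/par_Some[]//|].
exact: par_edge.
Qed.

(** The distance to the root along the parent function drops by one on each
    chosen edge.  This bounds the paths, makes their vertices distinct, and
    rules out undirected cycles. *)
Lemma parent_arborescence (Gam : digraph) (v : vertex Gam)
    (f : {ffun vertex Gam -> option (edge Gam)}) :
  f \in family (parent_choice v) -> reaches v f ->
  arborescence v (parent_edges f) /\ parent_of (parent_edges f) = f.
Proof.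
move=> /familyP valid /forallP reach.
have fE u e : f u = Some e -> source e = u /\ u != v.
  by move=> fu; have := valid u; rewrite fu => /andP[/eqP].
have fN u : f u = None -> u = v.
  by move=> fu; have := valid u; rewrite fu => /eqP.
set T := parent_edges f.
have TE e : (e \in T) = (f (source e) == Some e) by rewrite inE.
pose depth u := findex (step f) u v.
have depthE e : e \in T -> depth (source e) = (depth (target e)).+1.
  rewrite TE => /eqP fe; have [_ nv] := fE _ _ fe.
  by rewrite /depth fconnect_findex 1?eq_sym // /step fe.
have root_out e : e \in T -> source e != v.
  by rewrite TE => /eqP /fE[].
have walk_uniq u p q : walk u p v -> all (mem T) p -> walk u q v ->
    all (mem T) q -> p = q.
  elim: p u q => [|e p IHp] u [|a q] //=.
  - by move=> /eqP-> _ /andP[/eqP sa _] /andP[/root_out]; rewrite sa eqxx.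
  - move=> /andP[/eqP se _] /andP[/root_out + _] /eqP uv.
    by rewrite se uv eqxx.
  move=> /andP[/eqP se wp] /andP[eT pT] /andP[/eqP sa wq] /andP[aT qT].
  have eqea : e = a.
    by move: eT aT; rewrite !TE se sa => /eqP -> /eqP [].
  by rewrite -eqea in wq *; rewrite (IHp _ _ wp pT wq qT).
have path_ex k u : depth u = k -> exists2 p, dipath_in T u p v
    & all (fun w => depth w < k)%N (map (@target Gam) p).
  elim: k u => [|k IHk] u.
    by move/eqP; rewrite findex_eq0 => /eqP->; exists [::] => //;
    rewrite /dipath_in /= eqxx.
  move=> du; case fu: (f u) => [e|]; last first.
    by move: du; rewrite (fN _ fu) /depth findex0.
  have [se nv] := fE _ _ fu.
  have eT : e \in T by rewrite TE se fu.
  have dt : depth (target e) = k by have := depthE _ eT; rewrite se du => -[].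
  have [p /and3P[wp pT up] dp] := IHk _ dt.
  have dp' : all (fun w => depth w < k.+1)%N (map (@target Gam) (e :: p)).
    rewrite /= dt leqnn /=; apply: sub_all dp => w; exact: ltnW.
  exists (e :: p) => //; apply/and3P; split.
  - by rewrite /= se eqxx.
  - by rewrite /= eT.
  rewrite cons_uniq; apply/andP; split; last exact: up.
  by apply/negP=> up'; have := allP dp' u up'; rewrite du ltnn.
split; last first.
  apply/ffunP=> u; rewrite ffunE; case: pickP => [e /andP[]|none].
    by rewrite TE => /eqP + /eqP se; rewrite se.
  case fu: (f u) => [e|] //; have [se _] := fE _ _ fu.
  by have := none e; rewrite TE se fu !eqxx.
split; last first.
  move=> u; have [p pv _] := path_ex _ u erefl; exists p; split=> // q.
  case/and3P: pv => wp pT _ /and3P[wq qT _].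
  exact: walk_uniq wp pT wq qT.
split.
  (* u and w are joined by walking down to the root and back up. *)
  have fwd u w p : walk u p w -> all (mem T) p ->
      exists q, undirected_walk_in T u q w.
    move=> wp pT; exists (map (fun a => (a, true)) p); apply/andP; split.
      elim: p u wp {pT} => //= e p IHp u /andP[-> /IHp]; exact.
    by rewrite all_map; apply: sub_all pT.
  have cat_walk u w x p q : undirected_walk_in T u p w ->
      undirected_walk_in T w q x -> undirected_walk_in T u (p ++ q) x.
    case/andP=> wp pT /andP[wq qT]; rewrite /undirected_walk_in all_cat pT qT.
    rewrite !andbT; elim: p u wp {pT} => [|d p IHp] u /=; first by move/eqP->.
    by case/andP=> -> /IHp.
  have bwd u w p : walk u p w -> all (mem T) p ->
      exists q, undirected_walk_in T w q u.
    elim: p u => [|e p IHp] u /=.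
      by move/eqP-> => _; exists [::]; rewrite /undirected_walk_in /= eqxx.
    case/andP=> /eqP se /IHp{}IHp /andP[eT /IHp[q wq]].
    exists (q ++ [:: (e, false)]); apply: cat_walk wq _.
    by apply/andP; split; rewrite /= ?eqxx ?se ?eqxx ?andbT.
  move=> u w.
  have [p /and3P[wp pT _] _] := path_ex _ u erefl.
  have [q /and3P[wq qT _] _] := path_ex _ w erefl.
  have [[p' wp'] [q' wq']] := (fwd _ _ _ wp pT, bwd _ _ _ wq qT).
  by exists (p' ++ q'); apply: cat_walk wp' wq'.
move=> u p; apply/negP=> /and4P[/andP[wp pT] pn0 _ uE].
pose src := @source (undirected Gam); pose tgt := @target (undirected Gam).
have cyc : path.cycle (fun d d' => tgt d == src d') p.
  case: p pn0 wp {pT uE} => // d p _ /andP[/eqP <-].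
  suff path_walk a : @walk (undirected Gam) (tgt a) p (src d) ->
    path (fun d d' => tgt d == src d') a (rcons p d) by exact: path_walk.
  elim: p a => [|d' p IHp] a; first by rewrite /= andbT.
  by case/andP=> /eqP sd /IHp pd'; rewrite rcons_cons /= pd' andbT -sd.
have [d0 d0p] : exists d0, d0 \in p.
  by case: p pn0 {wp pT uE cyc} => // d p _; exists d; rewrite mem_head.
(* At a deepest vertex of the cycle, both cycle edges climb towards the root,
   so both are the parent edge of that vertex; one is traversed forwards and
   the other backwards, which the distinctness of cycle edges forbids. *)
case: (arg_maxnP (fun d => depth (src d)) d0p) => d dp dmax.
have /eqP td' := prev_cycle cyc dp; have /eqP td := next_cycle cyc dp.
have d'p : prev p d \in p by rewrite mem_prev.
have d''p : next p d \in p by rewrite mem_next.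
have := dmax _ d'p; have := dmax _ d''p; rewrite -td.
case dE: d td td' d'p dp => [e b] td td' d'p dp.
case d'E: (prev p (e, b)) td' d'p => [e' b'] td' d'p.
have eT : e \in T := allP pT _ dp.
have e'T : e' \in T := allP pT _ d'p.
have := (depthE _ eT, depthE _ e'T).
rewrite /src /tgt /= in td' *.
case: b b' {d'E dE} dp d'p td' td => [] [] //= dp d'p td' td [h1 h2].
- by move=> _; rewrite -td' h2 ltnn.
- move=> _ _.
  have eqe : e' = e.
    by move: eT e'T; rewrite !TE td' => /eqP -> /eqP [].
  rewrite eqe in d'p.
  have injE := uniq_map_inj uE.
  by have := injE _ _ dp d'p erefl.
- by rewrite h1 ltnn.
by rewrite h1 ltnn.
Qed.

(** * The matrix-tree theorem *)

Definition laplacian (R : comPzRingType) (Gam : digraph) (wt : edge Gam -> R)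
    (x y : vertex Gam) : R :=
  (if x == y then \sum_(e : edge Gam | source e == x) wt e else 0)
  - \sum_(e : edge Gam | (source e == x) && (target e == y)) wt e.

Definition parent_weight (R : comPzRingType) (Gam : digraph)
    (wt : edge Gam -> R) (o : option (edge Gam)) : R :=
  if o is Some e then wt e else 1.

(** The contribution of the choice o to the row of x. At the root, where o is
    None, this is the unit vector that the pinned Laplacian has there. *)
Definition parent_row (R : comPzRingType) (Gam : digraph) (x : vertex Gam)
    (o : option (edge Gam)) (y : vertex Gam) : R :=
  (x == y)%:R - (if o is Some e then (target e == y)%:R else 0).

Lemma laplacian_kernel (R : comPzRingType) (Gam : digraph)
    (wt : edge Gam -> R) (x : vertex Gam) :
  \sum_y laplacian wt x y = 0.
Proof.
rewrite sumrB -big_mkcond (big_pred1 x); last by move=> y; rewrite /= eq_sym.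
apply/eqP; rewrite subr_eq0; apply/eqP.
exact: (partition_big (@target Gam) predT).
Qed.

(** The vertex x is there because the determinant over no vertices is 1. *)
Lemma fdet_laplacian (R : comPzRingType) (Gam : digraph) (wt : edge Gam -> R)
    (x : vertex Gam) :
  fdet (laplacian wt) = 0.
Proof.
apply: (@fdet_kernel _ _ _ (fun=> 1) x) => // y.
by under eq_bigr do rewrite mulr1; exact: laplacian_kernel.
Qed.

Lemma pin_laplacian_parent (R : comPzRingType) (Gam : digraph)
    (wt : edge Gam -> R) (v x y : vertex Gam) :
  pin_row v (laplacian wt) x y
  = \sum_(o | parent_choice v x o) parent_weight wt o * parent_row R x o y.
Proof.
rewrite /pin_row; case: eqP => [->|/eqP nv].
  rewrite (big_pred1 None) => [|[e|]]; rewrite /= ?eqxx ?andbF //.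
  by rewrite mul1r /parent_row subr0 eq_sym.
rewrite (reindex_omap Some id) => [|[e|]] //=; last by rewrite (negPf nv).
under [RHS]eq_bigl do rewrite eqxx nv !andbT.
rewrite /parent_row; under [RHS]eq_bigr do rewrite /= mulrBr.
rewrite sumrB -mulr_suml; congr (_ - _).
  by case: eqP; rewrite ?mulr1 ?mulr0.
rewrite big_mkcondr; apply: eq_bigr => e _.
by case: eqP; rewrite ?mulr1 ?mulr0.
Qed.

(** If some vertices never reach the root, the indicator function of their set
    is invariant under the parent function and lies in the kernel.  If all
    vertices reach it, only the identity contributes to the Leibniz formula. *)
Lemma fdet_parent_rows (R : comPzRingType) (Gam : digraph) (v : vertex Gam)
    (f : {ffun vertex Gam -> option (edge Gam)}) :
  f \in family (parent_choice v) ->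
  fdet (fun x y => parent_row R x (f x) y) = (reaches v f)%:R.
Proof.
move=> /familyP valid.
have fv : f v = None.
  by have := valid v; case: (f v) => // e; rewrite unfold_in /= eqxx andbF.
have fN u : u != v -> exists2 e, f u = Some e & step f u = target e.
  move=> nv; rewrite /step; case fu: (f u) => [e|]; first by exists e.
  by have := valid u; rewrite fu unfold_in /= (negPf nv).
have [/forallP reach | /forallPn[u0 u0v]] := boolP (reaches v f); last first.
  pose c u : R := (~~ fconnect (step f) u v)%:R.
  apply: (@fdet_kernel _ _ _ c u0) => [x|]; last by rewrite /c u0v.
  rewrite /parent_row; under eq_bigr do rewrite mulrBl.
  rewrite sumrB (bigD1 x) //= eqxx mul1r big1 ?addr0; last first.
    by move=> y /negPf; rewrite eq_sym => ->; rewrite mul0r.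
  have [-> | /fN[e fx stepx]] := eqVneq x v.
    rewrite fv big1 ?subr0 => [|y _]; last by rewrite mul0r.
    by rewrite /c connect0.
  rewrite fx (bigD1 (target e)) //= eqxx mul1r big1 ?addr0; last first.
    by move=> y /negPf; rewrite eq_sym => ->; rewrite mul0r.
  suff -> : c (target e) = c x by rewrite subrr.
  congr ((~~ _)%:R); rewrite -stepx; apply/idP/idP.
    exact: connect_trans (fconnect1 _ _).
  move=> /iter_findex; case: (findex _ _ _) => [|k]; last first.
    by rewrite iterSr => <-; apply: fconnect_iter.
  by move=> /= xv; move: fx; rewrite xv fv.
rewrite /fdet /determinant (bigD1 1%g) //= odd_perm1 mul1r.
rewrite [X in X + _]big1 => [|i _]; last first.
  rewrite mxE perm1 /parent_row eqxx; have [-> | nv] := eqVneq (enum_val i) v.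
    by rewrite fv subr0.
  have [e -> stepx] := fN _ nv; case: eqP => [loop|_]; last by rewrite subr0.
  (* A loop at a non-root vertex would never reach the root. *)
  have := iter_findex (reach (enum_val i)).
  have -> k : iter k (step f) (enum_val i) = enum_val i.
    by elim: k => //= k ->; rewrite stepx.
  by move=> iv; rewrite iv eqxx in nv.
rewrite big1 ?addr0 // => s s1.
suff [i Mi0] : exists i, parent_row R (enum_val i) (f (enum_val i))
    (enum_val (s i)) = 0.
  by rewrite (bigD1 i) //= mxE Mi0 mul0r mulr0.
(* Otherwise s follows the parent function at every point it moves, so its
   moved points never lead to the root. *)
apply/not_existsP=> nz.
have sE i : s i != i -> enum_val (s i) = step f (enum_val i).
  move=> mi; have := nz i; rewrite /parent_row.
  have -> : (enum_val i == enum_val (s i)) = false.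
    by apply: contraNF mi => /eqP/enum_val_inj <-.
  rewrite /step; case: (f _) => [e|]; last by rewrite subr0.
  by case: eqP => [->|] //; rewrite subr0.
have [i mi] : exists i, s i != i.
  apply/existsP; apply: contraNT s1 => /existsPn all_fix.
  by apply/eqP/permP=> i; rewrite perm1; apply/eqP/negPn/all_fix.
have orbitE k : exists2 j, s j != j & enum_val j = iter k (step f) (enum_val i).
  elim: k => [|k [j mj jE]]; first by exists i.
  by exists (s j); rewrite ?(inj_eq perm_inj) // sE // jE.
have [j mj] := orbitE (findex (step f) (enum_val i) v).
rewrite iter_findex ?reach // => jv.
have := sE _ mj; rewrite jv {1}/step fv -jv => /enum_val_inj sj.
by rewrite sj eqxx in mj.
Qed.

Lemma arborescence_sum_parent (R : comPzRingType) (Gam : digraph)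
    (wt : edge Gam -> R) (v : vertex Gam) :
  arborescence_sum wt v
  = \sum_(f in family (parent_choice v) | reaches v f)
      \prod_x parent_weight wt (f x).
Proof.
rewrite /arborescence_sum (reindex_onto (@parent_edges Gam) (@parent_of Gam));
  last by move=> T /asboolP /arborescence_parent[].
apply: eq_big => [f|f /andP[/asboolP arb /eqP fK]].
  apply/andP/andP => [[/asboolP arb /eqP fK]|[fv fr]].
    by have [] := arborescence_parent arb; rewrite fK.
  by have [/asboolP-> ->] := parent_arborescence fv fr.
have [/familyP valid _ _] := arborescence_parent arb; rewrite fK in valid.
rewrite (partition_big (@source Gam) predT) //=; apply: eq_bigr => x _.
have := valid x; case fx: (f x) => [e|]; rewrite unfold_in /= => vx.
  have /andP[/eqP se _] := vx; apply: big_pred1 => a; rewrite inE /=.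
  apply/andP/eqP => [[/eqP fa /eqP sa]|->]; last by rewrite se fx eqxx.
  by move: fa; rewrite sa fx => -[].
by rewrite big_pred0 // => a; rewrite inE andbC; case: eqP => // ->; rewrite fx.
Qed.

Theorem matrix_tree (R : comPzRingType) (Gam : digraph) (wt : edge Gam -> R)
    (v : vertex Gam) :
  arborescence_sum wt v = fdet (pin_row v (laplacian wt)).
Proof.
rewrite (eq_fdet (pin_laplacian_parent wt v)).
rewrite (fdet_sum_rows _ (fun=> parent_weight wt) (@parent_row R Gam)).
rewrite arborescence_sum_parent big_mkcondr; apply: eq_bigr => f fv /=.
rewrite (_ : fdet _ = (reaches v f)%:R); last exact: fdet_parent_rows.
by case: ifP; rewrite ?mulr1 ?mulr0.
Qed.

(** * The derived graph of a voltage graph *)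

Definition voltage_arcs (R : comPzRingType) (G : finGroupType)
    (Gam : voltage_graph G) (wt : edge Gam -> R) (g : G)
    (x y : vertex Gam) : R :=
  \sum_(e : edge Gam | [&& source e == x, target e == y & voltage e == g]) wt e.

(** An edge over (x, y) runs from (x, a) to (y, b) exactly when its voltage is
    b * a^-1. *)
Lemma derived_laplacian (R : comPzRingType) (G : finGroupType)
    (Gam : voltage_graph G) (wt : edge Gam -> R)
    (p q : vertex (derived_graph Gam)) :
  laplacian (derived_weight wt) p q
  = (if p == q then \sum_(e : edge Gam | source e == p.1) wt e else 0)
    - voltage_arcs wt (q.2 * p.2^-1)%g p.1 q.1.
Proof.
case: p q => [x a] [y b]; rewrite /laplacian /derived_weight /=.
have fiberE (P : pred (edge Gam * G)) : (forall e c, P (e, c) -> c = a) ->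
    \sum_(ex | P ex) wt ex.1 = \sum_(e | P (e, a)) wt e.
  move=> Pa; rewrite (reindex_onto (fun e => (e, a)) fst) /=.
    by apply: eq_bigl => e; rewrite eqxx andbT.
  by case=> e c /Pa ->.
congr ((if _ then _ else _) - _).
  rewrite fiberE => [|e c /eqP[]] //.
  by apply: eq_bigl => e; rewrite xpair_eqE eqxx andbT.
rewrite fiberE => [|e c /andP[/eqP[_ ->]]] //.
apply: eq_bigl => e; rewrite !xpair_eqE eqxx andbT eq_mulgV1.
by rewrite [in RHS](eq_mulgV1 (voltage e)) invMg invgK mulgA.
Qed.

(** Right translation by a group element is an automorphism of the derived
    graph, and it permutes the lifts of a vertex transitively. *)
Lemma lift_independent (R : comPzRingType) (G : finGroupType)
    (Gam : voltage_graph G) (wt : edge Gam -> R) (v : vertex Gam) (a b : G) :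
  arborescence_sum (Gam := derived_graph Gam) (derived_weight wt) (v, a)
  = arborescence_sum (Gam := derived_graph Gam) (derived_weight wt) (v, b).
Proof.
rewrite !matrix_tree; pose g := (a^-1 * b)%g.
pose h (p : vertex (derived_graph Gam)) : vertex (derived_graph Gam) :=
  (p.1, p.2 * g)%g.
have bij_h : bijective h.
  by exists (fun p => (p.1, p.2 * g^-1)%g) => -[x c];
    rewrite /h /= ?mulgK ?mulgKV.
have hv : h (v, a) = (v, b) by rewrite /h /g /= mulKVg.
rewrite -[RHS](fdet_reindex _ bij_h) -hv; apply: eq_fdet => p q.
rewrite /pin_row !(inj_eq (bij_inj bij_h)); case: ifP => // _.
rewrite !derived_laplacian (inj_eq (bij_inj bij_h)) /= invMg mulgA.
by rewrite mulgK.
Qed.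

(** * Double covers *)

Definition signed_laplacian (R : comPzRingType) (Gam : voltage_graph 'Z_2)
    (wt : edge Gam -> R) (x y : vertex Gam) : R :=
  (if x == y then \sum_(e : edge Gam | source e == x) wt e else 0)
  - \sum_(e : edge Gam | (source e == x) && (target e == y))
      reduced_Z2 R (voltage e) * wt e.

Lemma Z2_cases (a : 'Z_2) : a = 0 \/ a = 1.
Proof. by case: a => [[|[|//]] lt]; [left | right]; apply/val_inj. Qed.

Lemma laplacian_voltage (R : comPzRingType) (Gam : voltage_graph 'Z_2)
    (wt : edge Gam -> R) (x y : vertex Gam) :
  laplacian wt x y =
    (if x == y then \sum_(e : edge Gam | source e == x) wt e else 0)
    - voltage_arcs wt (0 : 'Z_2) x y - voltage_arcs wt (1%R : 'Z_2) x y.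
Proof.
rewrite /laplacian -addrA -opprD; congr (_ - _).
rewrite (bigID (fun e => voltage e == 0 :> 'Z_2)) /=; congr (_ + _).
  by apply: eq_bigl => e; rewrite andbA.
apply: eq_bigl => e; rewrite andbA; congr (_ && _).
by case: (Z2_cases (voltage e)) => ->.
Qed.

Lemma signed_laplacian_voltage (R : comPzRingType) (Gam : voltage_graph 'Z_2)
    (wt : edge Gam -> R) (x y : vertex Gam) :
  signed_laplacian wt x y =
    (if x == y then \sum_(e : edge Gam | source e == x) wt e else 0)
    - voltage_arcs wt (0 : 'Z_2) x y + voltage_arcs wt (1%R : 'Z_2) x y.
Proof.
rewrite /signed_laplacian -addrA.
rewrite -[voltage_arcs wt (1%R : 'Z_2) x y]opprK -opprD.
congr (_ - _).
rewrite (bigID (fun e => voltage e == 0 :> 'Z_2)) /=; congr (_ + _).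
  under eq_bigl do rewrite -andbA.
  by apply: eq_bigr => e /and3P[_ _ /eqP->]; rewrite /reduced_Z2 eqxx mul1r.
rewrite -sumrN; apply: eq_big => e.
  rewrite -andbA; do 2!congr (_ && _).
  by case: (Z2_cases (voltage e)) => ->.
by case: (Z2_cases (voltage e)) => -> /andP[_]; rewrite // /reduced_Z2 mulN1r.
Qed.

(** With the sheets as blocks, edges of voltage 0 stay in their sheet and edges
    of voltage 1 change it, so the two diagonal blocks agree and so do the two
    off-diagonal ones. The same t in both sheets preserves this shape. *)
Lemma double_cover_fdet (R : comPzRingType) (Gam : voltage_graph 'Z_2)
    (wt : edge Gam -> R) (v : vertex Gam) (t : R) :
  fdet (add_diag ((v, 1%R : 'Z_2) : vertex (derived_graph Gam)) t
         (add_diag ((v, 0 : 'Z_2) : vertex (derived_graph Gam)) t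
           (laplacian (derived_weight wt))))
  = fdet (add_diag v t (laplacian wt))
    * fdet (add_diag v t (signed_laplacian wt)).
Proof.
set n := #|vertex Gam|.
pose h (i : 'I_(n + n)) : vertex (derived_graph Gam) :=
  match split i with
  | inl j => (enum_val j, 0 : 'Z_2)
  | inr j => (enum_val j, 1%R : 'Z_2)
  end.
have bij_h : bijective h.
  exists (fun p => unsplit (if p.2 == 0 :> 'Z_2 then inl (enum_rank p.1)
                            else inr (enum_rank p.1))) => [i | [x a]].
    rewrite /h -[RHS]splitK.
    by case: (split i) => j /=; rewrite enum_valK.
  by rewrite /h unsplitK; case: (Z2_cases a) => -> /=; rewrite enum_rankK.
rewrite -(fdet_bij _ bij_h).
pose P : 'M[R]_n := \matrix_(i, j) (add_diag v t (fun x y =>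
  (if x == y then \sum_(e : edge Gam | source e == x) wt e else 0)
  - voltage_arcs wt (0 : 'Z_2) x y)) (enum_val i) (enum_val j).
pose Q : 'M[R]_n := - \matrix_(i, j)
  voltage_arcs wt (1%R : 'Z_2) (enum_val i) (enum_val j).
have -> : fdet (add_diag v t (laplacian wt)) = \det (P + Q).
  congr (\det _); apply/matrixP=> i j.
  by rewrite !mxE /add_diag laplacian_voltage addrAC.
have -> : fdet (add_diag v t (signed_laplacian wt)) = \det (P - Q).
  congr (\det _); apply/matrixP=> i j.
  by rewrite !mxE /add_diag signed_laplacian_voltage opprK addrAC.
rewrite -det_block_swap; congr (\det _); apply/matrixP=> i j.
rewrite !mxE /h /add_diag !derived_laplacian.
case: (split i) => k; rewrite !mxE; case: (split j) => l; rewrite !mxE /=.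
all: rewrite !xpair_eqE /= ?andbT ?andbF ?addr0 ?add0r ?sub0r //.
Qed.

(** The ratio formula without denominators, for arbitrary weights: it compares
    the linear coefficients in t of the two sides of [double_cover_fdet]. *)
Theorem double_cover_arborescences (R : comPzRingType)
    (Gam : voltage_graph 'Z_2) (wt : edge Gam -> R)
    (vt : vertex (derived_graph Gam)) :
  arborescence_sum (derived_weight wt) vt *+ 4
  = arborescence_sum wt vt.1 * fdet (signed_laplacian wt) *+ 2.
Proof.
set v := vt.1.
pose A := arborescence_sum (derived_weight wt) vt.
pose v0 : vertex (derived_graph Gam) := (v, 0 : 'Z_2).
pose v1 : vertex (derived_graph Gam) := (v, 1%R : 'Z_2).
pose Lt := laplacian (derived_weight wt).
have A0 : fdet (pin_row v0 Lt) = A.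
  rewrite -matrix_tree /A /v0 (lift_independent _ _ _ vt.2).
  by rewrite /v; case: (vt).
have A1 : fdet (pin_row v1 Lt) = A.
  rewrite -matrix_tree /A /v1 (lift_independent _ _ _ vt.2).
  by rewrite /v; case: (vt).
pose B := fdet (pin_row v0 (pin_row v1 Lt)).
pose C := fdet (pin_row v (signed_laplacian wt)).
have expand t : t * A + t * (A + t * B)
    = t * arborescence_sum wt v * (fdet (signed_laplacian wt) + t * C).
  have := double_cover_fdet wt v t.
  rewrite !fdet_add_diag (fdet_laplacian _ v0) (fdet_laplacian _ v) !add0r.
  rewrite -(matrix_tree wt v) A0 -/C => <-; congr (_ + _ * _).
  rewrite -A1 /B -(fdet_add_diag v0); apply: eq_fdet => p q.
  rewrite /add_diag /pin_row; case: (p =P v1) => // ->.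
  by rewrite (_ : (v1 == v0) = false) ?addr0 // xpair_eqE andbF.
(* The identity holds for every scalar t, and both sides are divisible by t and
   quadratic in it: subtracting t = -1 from t = 1 leaves twice the linear
   coefficients. *)
rewrite -/A; have -> : A *+ 4 =
    (1 * A + 1 * (A + 1 * B)) - (-1 * A + -1 * (A + -1 * B)) by ring.
by rewrite !expand; ring.
Qed.

(** * The ratio of arborescence sums *)

Lemma voltage_laplacianE (Gam : voltage_graph 'Z_2) :
  \det (voltage_laplacian Gam) = fdet (signed_laplacian (@weight Gam)).
Proof.
congr (\det _); apply/matrixP=> i j.
by rewrite !mxE /signed_laplacian (inj_eq enum_val_inj).
Qed.

Lemma two_edge_poly_neq0 (Gam : digraph) : (2%:R : edge_poly Gam) != 0.
Proof. by rewrite -mpolyC_nat mpolyC_eq0. Qed.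

Theorem corollary1p5 (Gam : voltage_graph 'Z_2) (v : vertex Gam)
    (vt : vertex (derived_graph Gam)) :
  arborescence_sum (@weight Gam) v != 0 ->
  is_lift v vt ->
  tofrac (arborescence_sum (derived_weight (@weight Gam)) vt)
    / tofrac (arborescence_sum (@weight Gam) v)
  = 2%:R^-1 * tofrac (\det (voltage_laplacian Gam))
    :> {fraction (edge_poly Gam)}.
Proof.
move=> Av0 lift_vt; have := double_cover_arborescences (@weight Gam) vt.
rewrite lift_vt -voltage_laplacianE => cover.
have {}cover : 2%:R * arborescence_sum (derived_weight (@weight Gam)) vt
    = arborescence_sum (@weight Gam) v * \det (voltage_laplacian Gam).
  apply: (mulfI (two_edge_poly_neq0 Gam)).
  by rewrite mulrA -natrM !mulr_natl.
have two0 : (2%:R : {fraction (edge_poly Gam)}) != 0.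
  by rewrite -(rmorph_nat (tofrac (R := edge_poly Gam))) tofrac_eq0
    two_edge_poly_neq0.
have frac_Av0 : tofrac (arborescence_sum (@weight Gam) v) != 0.
  by rewrite tofrac_eq0.
apply: (canLR (mulfK frac_Av0)); apply: (mulfI two0).
rewrite !mulrA mulfV // mul1r mulrC [RHS]mulrC -[RHS]rmorphM -cover.
by rewrite rmorphM rmorph_nat mulrC.
Qed.
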